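(* Let $(X,d,W)$ be a complete $UCW$-hyperbolic space, $C\subseteq X$ a nonempty convex closed subset and $T:C\to C$ nonexpansive. The following are equivalent. (i) $T$ has fixed points. (ii) There exists a bounded sequence $(u_n)$ in $C$ such that $\lim_{n\to\infty} d(u_n,Tu_n)=0$. (iii) The sequence $(T^nx)$ of Picard iterates is bounded for some $x\in C$. (iv) The sequence $(T^nx)$ of Picard iterates is bounded for all $x\in C$. (v) The Krasnoselski-Mann iteration $(x_n)$ is bounded for some $x\in C$ and for some sequence $(\lambda_n)$ in $[0,1]$ satisfying one of the following conditions: (a) $\lambda_n=\lambda\in(0,1]$ for all $n$; (b) $\lim_{n\to\infty}\lambda_n=1$; (c) $\limsup_n\lambda_n<1$ and $\sum_{n=0}^\infty\lambda_n$ diverges. (vi) The Krasnoselski-Mann iteration $(x_n)$ is bounded for all $x\in C$ and all $(\lambda_n)$ in $[0,1]$.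
   Context: A $W$-hyperbolic space $(X,d,W)$ is a metric space $(X,d)$ with a map $W:X\times X\times[0,1]\to X$ such that for all $x,y,z,w\in X$, $\lambda,\tilde\lambda\in[0,1]$: (W1) $d(z,W(x,y,\lambda))\le(1-\lambda)d(z,x)+\lambda d(z,y)$; (W2) $d(W(x,y,\lambda),W(x,y,\tilde\lambda))=|\lambda-\tilde\lambda|\,d(x,y)$; (W3) $W(x,y,\lambda)=W(y,x,1-\lambda)$; (W4) $d(W(x,z,\lambda),W(y,w,\lambda))\le(1-\lambda)d(x,y)+\lambda d(z,w)$. Write $(1-\lambda)x\oplus\lambda y:=W(x,y,\lambda)$. A nonempty $C\subseteq X$ is convex if $(1-\lambda)x\oplus\lambda y\in C$ for all $x,y\in C$, $\lambda\in[0,1]$. $(X,d,W)$ is uniformly convex with modulus of uniform convexity $\eta:(0,\infty)\times(0,2]\to(0,1]$ if for all $r>0$, $\varepsilon\in(0,2]$, $a,x,y\in X$: $d(x,a)\le r$, $d(y,a)\le r$, $d(x,y)\ge\varepsilon r$ imply $d(\frac12x\oplus\frac12y,a)\le(1-\eta(r,\varepsilon))r$. The modulus $\eta$ is monotone if it decreases with $r$ for fixed $\varepsilon$ (i.e. $\eta(s,\varepsilon)\le\eta(r,\varepsilon)$ whenever $s\ge r$). A $UCW$-hyperbolic space is a uniformly convex $W$-hyperbolic space admitting a monotone modulus of uniform convexity. $T:C\to C$ is nonexpansive if $d(Tx,Ty)\le d(x,y)$ for all $x,y\in C$. For a sequence $(\lambda_n)$ in $[0,1]$, the Krasnoselski-Mann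 iteration starting with $x\in C$ is $x_0:=x$, $x_{n+1}:=(1-\lambda_n)x_n\oplus\lambda_nTx_n$. $\mathbb{N}$ includes $0$. *)

(* Defs.v *)
From HB Require Import structures.
From mathcomp Require Import all_boot all_order all_algebra.
From mathcomp Require Import all_classical all_reals all_analysis.

Set Implicit Arguments.
Unset Strict Implicit.
Unset Printing Implicit Defensive.

Import Order.TTheory GRing.Theory Num.Theory.
Import numFieldNormedType.Exports.

Local Open Scope classical_set_scope.
Local Open Scope ring_scope.

#[short(type="completeMetricType")]
HB.structure Definition CompleteMetric (R : numDomainType) :=
  {M of Complete M & Metric R M}.

(* A convexity mapping is a total function [W : X -> X -> R -> X]: its values at
   parameters outside [0, 1] are never used. The term [W x y l] stands for
   (1 - l) x (+) l y, so the parameter is the weight of the second point. *)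

Record W_hyperbolic (R : realType) (X : metricType R) (W : X -> X -> R -> X) :
    Prop := {
  W_conv : forall (x y z : X) (l : R), 0 <= l <= 1 ->
    mdist z (W x y l) <= (1 - l) * mdist z x + l * mdist z y ;
  W_isom : forall (x y : X) (l l' : R), 0 <= l <= 1 -> 0 <= l' <= 1 ->
    mdist (W x y l) (W x y l') = `|l - l'| * mdist x y ;
  W_sym : forall (x y : X) (l : R), 0 <= l <= 1 ->
    W x y l = W y x (1 - l) ;
  W_quad : forall (x y z w : X) (l : R), 0 <= l <= 1 ->
    mdist (W x z l) (W y w l) <= (1 - l) * mdist x y + l * mdist z w
}.

(* The modulus is a total function as well, constrained only on its domain
   (0, oo) x (0, 2], where its values lie in (0, 1]. *)

Record uniform_convexity_modulus (R : realType) (X : metricType R)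
    (W : X -> X -> R -> X) (eta : R -> R -> R) : Prop := {
  modulus_itv : forall r e : R, 0 < r -> 0 < e <= 2 -> 0 < eta r e <= 1 ;
  modulus_convex : forall (r e : R) (a x y : X), 0 < r -> 0 < e <= 2 ->
    mdist x a <= r -> mdist y a <= r -> e * r <= mdist x y ->
    mdist (W x y 2^-1) a <= (1 - eta r e) * r
}.

Definition monotone_modulus (R : realType) (eta : R -> R -> R) : Prop :=
  forall r s e : R, 0 < r -> r <= s -> 0 < e <= 2 -> eta s e <= eta r e.

Definition UCW_hyperbolic (R : realType) (X : metricType R)
    (W : X -> X -> R -> X) : Prop :=
  W_hyperbolic W /\
  exists eta : R -> R -> R,
    uniform_convexity_modulus W eta /\ monotone_modulus eta.

Definition W_convex (R : realType) (X : metricType R) (W : X -> X -> R -> X)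
    (C : set X) : Prop :=
  forall (x y : X) (l : R), C x -> C y -> 0 <= l <= 1 -> C (W x y l).

Definition nonexpansive_on (R : realType) (X : metricType R) (C : set X)
    (T : X -> X) : Prop :=
  forall x y : X, C x -> C y -> mdist (T x) (T y) <= mdist x y.

(* The library's [bounded_set] is only available in normed modules. *)
Definition metric_bounded (R : realType) (X : metricType R) (A : set X) : Prop :=
  exists M : R, forall x y : X, A x -> A y -> mdist x y <= M.

Fixpoint KM_iteration (R : realType) (X : metricType R) (W : X -> X -> R -> X)
    (T : X -> X) (lambda : nat -> R) (x : X) (n : nat) : X :=
  match n with
  | 0%N => x
  | n'.+1 => let xn := KM_iteration W T lambda x n' in W xn (T xn) (lambda n')
  end.

Definition unit_itv_seq (R : realType) (lambda : nat -> R) : Prop :=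
  forall n : nat, 0 <= lambda n <= 1.

Definition KM_condition (R : realType) (lambda : nat -> R) : Prop :=
  [\/ exists2 l : R, 0 < l <= 1 & forall n : nat, lambda n = l,
      lambda n @[n --> \oo] --> (1 : R)
    | limn_sup lambda < 1 /\ ~ cvgn (series lambda)].

(* Main.v *)
(** The asymptotic centre of a bounded sequence [u] in [C] is the unique point
    of [C] minimising [limsup_n d(y, u_n)]; uniform convexity with a monotone
    modulus makes minimising sequences Cauchy, so completeness provides it.
    If [c] is the asymptotic centre of an approximate fixed point sequence, or
    of a bounded Krasnoselski-Mann iteration with divergent [sum lambda_n], then
    [T c] is a minimiser too, so [T c = c]. For the iteration this follows from
    [d(Tc, x_(n+1)) <= (1 - lambda_n) d(Tc, x_n) + lambda_n d(c, x_n)], which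
    pulls [limsup d(Tc, x_n)] below [limsup d(c, x_n)]. Divergence of the sum
    holds in each of the cases (a), (b), (c), and the Picard iteration is the
    case [lambda_n = 1]. *)

Require Import Defs.
From mathcomp Require Import all_boot all_order all_algebra.
From mathcomp Require Import all_classical all_reals all_analysis.
From mathcomp Require Import lra.
Import Order.TTheory GRing.Theory Num.Theory.
Import numFieldNormedType.Exports.
Local Open Scope classical_set_scope.
Local Open Scope ring_scope.

(** * Divergent sums of weights *)

(** Once a term from [N] on is at most [d], so are all later ones. If instead all terms from [N] on
    exceed [d], each step lowers [t] by at least [lambda n * d], so the partial sums stay below
    [series lambda N + t N / d] and converge. *)
Lemma series_dvg_relaxation {R : realType} (lambda t : nat -> R) (N : nat)
    (d : R) : unit_itv_seq lambda -> ~ cvgn (series lambda) -> 0 < d ->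
  (forall n, (N <= n)%N -> t n.+1 <= (1 - lambda n) * t n) ->
  \forall n \near \oo, t n <= d.
Proof.
move=> lambda01 dvg d0 step.
have [[m Nm tm]|small] := pselect (exists2 m, (N <= m)%N & t m <= d).
  exists m => // n /= mn; rewrite -(subnKC mn); elim: (n - m)%N => [|k IHk].
    by rewrite addn0.
  rewrite addnS (le_trans (step _ (leq_trans Nm (leq_addr _ _))))//.
  have /andP[l0 l1] := lambda01 (m + k)%N; nra.
exfalso; apply: dvg.
have large n : (N <= n)%N -> d < t n.
  by move=> Nn; rewrite ltNge; apply/negP => tn; apply: small; exists n.
have descent k : t (N + k)%N <=
    t N - d * (series lambda (N + k)%N - series lambda N).
  elim: k => [|k IHk]; first by rewrite addn0 subrr mulr0 subr0.
  rewrite addnS (le_trans (step _ (leq_addr _ _)))//.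
  rewrite /series /= big_nat_recr//= -[\sum_(0 <= _ < _) _]/(series lambda _).
  have /andP[l0 l1] := lambda01 (N + k)%N.
  have := large _ (leq_addr k N).
  rewrite /series /= in IHk *; nra.
have nd : nondecreasing_seq (series lambda).
  by apply/nondecreasing_series => n _ _; have /andP[] := lambda01 n.
apply: nondecreasing_is_cvgn => //.
exists (series lambda N + t N / d) => _ [n _ <-].
rewrite (le_trans (nd _ _ (leq_addl N n)))// -lerBlDl ler_pdivlMr// mulrC.
have := descent n; have := large _ (leq_addr n N); rewrite /= addnC; lra.
Qed.

(** Convergence would force the weights to 0, against their limits [l > 0] in (a) and 1 in (b); case
    (c) assumes divergence. *)
Lemma KM_condition_dvg {R : realType} (lambda : nat -> R) :
  KM_condition lambda -> ~ cvgn (series lambda).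
Proof.
move=> [[l /andP[l0 _] lE]|lambda1|[]//] /cvg_series_cvg_0 lambda0.
- have lambdaE : lambda = (fun=> l) by apply/funext.
  rewrite lambdaE in lambda0.
  have l_eq0 : l = 0 := cvg_unique (@norm_hausdorff R R) (cvg_cst l) lambda0.
  by rewrite l_eq0 ltxx in l0.
- have one_eq0 : 1 = 0 :> R := cvg_unique (@norm_hausdorff R R) lambda1 lambda0.
  by have := oner_neq0 R; rewrite one_eq0 eqxx.
Qed.

(** * Metric and convexity preliminaries *)

Lemma metric_bounded_fixed_dist {R : realType} {X : metricType R} (p : X)
    (u : nat -> X) (M : R) :
  (forall n, mdist (u n) p <= M) -> metric_bounded (range u).
Proof.
move=> uM; exists (M + M) => _ _ [m _ <-] [n _ <-].
by rewrite (le_trans (metric_triangle _ p _))// lerD// metric_sym.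
Qed.

Lemma W_conv_l {R : realType} {X : metricType R} {W : X -> X -> R -> X}
    (HW : W_hyperbolic W) (x y z : X) (l : R) : 0 <= l <= 1 ->
  mdist (W x y l) z <= (1 - l) * mdist x z + l * mdist y z.
Proof.
by rewrite (metric_sym _ z) (metric_sym x) (metric_sym y); exact: W_conv.
Qed.

Lemma W_weight1 {R : realType} {X : metricType R} {W : X -> X -> R -> X}
    (HW : W_hyperbolic W) (x y : X) : W x y 1 = y.
Proof.
apply: mdist_positivity; apply/eqP; rewrite eq_le mdist_ge0 andbT.
have := @W_conv_l _ _ _ HW x y y 1.
by rewrite mdistxx subrr mul0r mulr0 addr0 ler01 lexx; exact.
Qed.

(** * Asymptotic radius and asymptotic centre *)

Section asymptotic_center.
Context {R : realType} {X : metricType R}.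
Implicit Types (C : set X) (u : nat -> X) (c y : X).

(** [inf_(y in C) limsup_n d(y, u_n)], written without the limsup: [s] is
    admissible when [d(y, u_n)] is eventually at most [s] for some [y]. *)
Definition asymptotic_radius C u : R :=
  inf [set s | exists2 y, C y & \forall n \near \oo, mdist y (u n) <= s].

(** The second clause says that limsup_n d(c, u_n) is at most the radius, so [c] attains the
    infimum. *)
Definition asymptotic_center C u c : Prop := C c /\ forall d : R, 0 < d ->
  \forall n \near \oo, mdist c (u n) <= asymptotic_radius C u + d.

Let admissible_ge0 C u : lbound
  [set s | exists2 y, C y & \forall n \near \oo, mdist y (u n) <= s] 0.
Proof.
move=> s [y _ [N _ /(_ N (leqnn N))]]; apply: le_trans; exact: mdist_ge0.
Qed.

Lemma asymptotic_radius_le C u y (s : R) : C y ->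
  (\forall n \near \oo, mdist y (u n) <= s) -> asymptotic_radius C u <= s.
Proof. by move=> Cy ys; apply: ge_inf; [exists 0|exists y]. Qed.

(** Boundedness of [u] makes the admissible set nonempty, so that its [inf] is a genuine infimum. *)
Lemma asymptotic_radius_adherent C u (d : R) :
  C !=set0 -> metric_bounded (range u) -> 0 < d ->
  exists2 y, C y &
    \forall n \near \oo, mdist y (u n) <= asymptotic_radius C u + d.
Proof.
move=> [y Cy] [M uM] d0.
have [|s [z Cz zs] sd] := @inf_adherent _
    [set s | exists2 y, C y & \forall n \near \oo, mdist y (u n) <= s] _ d0.
  split; last by exists 0.
  exists (mdist y (u 0%N) + M); exists y => //; near=> n.
  by rewrite (le_trans (metric_triangle _ (u 0%N) _))// lerD2l uM//; exists n.
exists z => //; near=> n; apply: (le_trans _ (ltW sd)); near: n; exact: zs.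
Unshelve. all: end_near. Qed.

Variables (W : X -> X -> R -> X) (HW : UCW_hyperbolic W).

(** If two near-minimizers were [e] apart, uniform convexity would make their midpoint, a point of
    [C], beat the radius. *)
Lemma asymptotic_radius_near_minimizers C u (e : R) : W_convex W C -> 0 < e ->
  exists2 d : R, 0 < d & forall x y, C x -> C y ->
    (\forall n \near \oo, mdist x (u n) <= asymptotic_radius C u + d) ->
    (\forall n \near \oo, mdist y (u n) <= asymptotic_radius C u + d) ->
    mdist x y < e.
Proof.
case: HW => _ [eta [eta_mod eta_mono]] Cconv e0.
set r := asymptotic_radius C u.
(* A small radius, possibly 0, needs only the triangle inequality: [2 * (r + e / 8) < e]. *)
have [r0|r0] := ltP r (e / 4).
  exists (e / 8) => [|x y Cx Cy xr yr]; first by lra.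
  near \oo => n.
  have xn : mdist x (u n) <= r + e / 8 by near: n.
  have yn : mdist y (u n) <= r + e / 8 by near: n.
  have := metric_triangle x (u n) y; rewrite (metric_sym (u n)); lra.
(* Points [e] apart are then [k * (r + d)] apart for every [d <= 1], so [k] can be fixed before [d];
   the cap 2 keeps it in the domain of the modulus. *)
pose k := Num.min (e / (r + 1)) 2.
have k02 : 0 < k <= 2.
  by rewrite /k lt_min ge_min lexx orbT divr_gt0//=; lra.
have kr : k * (r + 1) <= e.
  by rewrite -ler_pdivlMr ?ge_min ?lexx//; lra.
have [eta0 eta1] : 0 < eta (r + 1) k /\ eta (r + 1) k <= 1.
  by apply/andP; apply: (modulus_itv eta_mod) => //; lra.
set h := eta (r + 1) k in eta0 eta1.
(* [d <= h r / 2] puts the midpoint radius [(1 - h)(r + d)] below [r], and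
   [d <= 1] lets [eta (r + 1)] bound [eta (r + d)] from below. *)
pose d := Num.min (h * r / 2) 1.
have d0 : 0 < d by rewrite /d lt_min ltr01 andbT; nra.
have [dh d1] : d <= h * r / 2 /\ d <= 1.
  by rewrite /d !ge_min !lexx orbT.
exists d => // x y Cx Cy xr yr; rewrite ltNge; apply/negP => exy.
have half01 : 0 <= (2^-1 : R) <= 1 by lra.
have : r <= (1 - h) * (r + d).
  apply: (@asymptotic_radius_le C u (W x y 2^-1)); first exact: Cconv.
  near=> n.
  have hh : h <= eta (r + d) k by apply: eta_mono => //; lra.
  have rd0 : 0 < r + d by lra.
  have xn : mdist x (u n) <= r + d by near: n.
  have yn : mdist y (u n) <= r + d by near: n.
  apply: (le_trans (modulus_convex eta_mod rd0 k02 xn yn _)).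
    by case/andP: k02 => k0 _; nra.
  by rewrite ler_wpM2r//; lra.
nra.
Unshelve. all: end_near. Qed.

Lemma asymptotic_center_unique C u c y : W_convex W C ->
  asymptotic_center C u c -> asymptotic_center C u y -> y = c.
Proof.
move=> Cconv [Cc cr] [Cy yr]; apply/eqP/negPn; rewrite -mdist_gt0.
apply/negP => yc0.
have [d d0 /(_ y c Cy Cc (yr d d0) (cr d d0))] :=
  asymptotic_radius_near_minimizers C u _ Cconv yc0.
by rewrite ltxx.
Qed.

End asymptotic_center.

Lemma asymptotic_center_exists {R : realType} {X : completeMetricType R}
    (W : X -> X -> R -> X) (C : set X) (u : nat -> X) : UCW_hyperbolic W ->
  C !=set0 -> W_convex W C -> closed C -> metric_bounded (range u) ->
  exists c, asymptotic_center C u c.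
Proof.
move=> HW C0 Cconv Cclosed ub; set r := asymptotic_radius C u.
have /choice[y yP] k : exists y, C y /\
    \forall n \near \oo, mdist y (u n) <= r + k.+1%:R^-1.
  have [|y Cy yr] := @asymptotic_radius_adherent _ _ C u k.+1%:R^-1 C0 ub.
    by rewrite invr_gt0.
  by exists y.
have yC k : C (y k) by case: (yP k).
have yr (d : R) : 0 < d -> \forall k \near \oo,
    \forall n \near \oo, mdist (y k) (u n) <= r + d.
  move=> d0; near=> k; have [_ yk] := yP k; near=> n.
  have /le_trans -> // : mdist (y k) (u n) <= r + k.+1%:R^-1 by near: n.
  rewrite lerD2l ltW//; near: k; exact: (near_infty_natSinv_lt (PosNum d0)).
have ycauchy : cauchy (y @ \oo).
  apply: cauchy_exP => e e0.
  have [d d0 dP] := asymptotic_radius_near_minimizers _ HW C u _ Cconv e0.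
  have [N _ NP] := yr d d0.
  exists (y N); exists N => // k /= Nk.
  by rewrite ballEmdist /=; apply: dP => //; apply: NP => /=.
have yc : y @ \oo --> lim (y @ \oo) by exact: cauchy_cvg.
set c := lim _ in yc; exists c; split.
  by apply: (closed_cvg C Cclosed _ c yc); near=> k; exact: yC.
move=> d d0.
have d20 : 0 < d / 2 by lra.
have /cvg_ballP/(_ _ d20) yc2 := yc.
(* A single [k] serves all large [n]: one half of [d] pays for the distance from [c] to [y k], the
   other for the excess of [y k] over the radius. *)
near \oo => k.
have cyk : mdist c (y k) < d / 2.
  have : ball c (d / 2) (y k) by near: k.
  by rewrite ballEmdist.
have yk : \forall n \near \oo, mdist (y k) (u n) <= r + d / 2.
  by near: k; exact: yr.
near=> n.
have : mdist (y k) (u n) <= r + d / 2 by near: n.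
have := metric_triangle c (y k) (u n).
rewrite -/r; lra.
Unshelve. all: end_near. Qed.

(** * Fixed points and bounded iterations *)

Section fixed_points.
Context {R : realType} {X : completeMetricType R}.
Variables (W : X -> X -> R -> X) (HW : UCW_hyperbolic W).
Variables (C : set X) (T : {fun C >-> C}) (Tne : nonexpansive_on C T).

Lemma approx_fixed_point_fixed (u : nat -> X) : C !=set0 -> W_convex W C ->
  closed C -> (forall n, C (u n)) -> metric_bounded (range u) ->
  mdist (u n) (T (u n)) @[n --> \oo] --> (0 : R) ->
  exists2 p, C p & T p = p.
Proof.
move=> C0 Cconv Cclosed uC ub uT.
have [c cc] := asymptotic_center_exists _ _ _ HW C0 Cconv Cclosed ub.
have [Cc cr] := cc.
exists c => //; apply: (asymptotic_center_unique _ HW _ _ _ _ Cconv cc).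
split=> [|d d0]; first exact: funS.
have d20 : 0 < d / 2 by lra.
near=> n.
have uTn : mdist (u n) (T (u n)) < d / 2 by near: n; exact: (cvgr_lt _ uT).
have : mdist c (u n) <= asymptotic_radius C u + d / 2 by near: n; exact: cr.
have := Tne _ _ Cc (uC n).
have := metric_triangle (T c) (T (u n)) (u n).
rewrite (metric_sym (T (u n)) (u n)); lra.
Unshelve. all: end_near. Qed.

Lemma KM_iteration_in (lambda : nat -> R) (x : X) : W_convex W C ->
  unit_itv_seq lambda -> C x -> forall n, C (KM_iteration W T lambda x n).
Proof.
by move=> Cconv lambda01 Cx; elim=> //= n IHn; apply: Cconv => //; exact: funS.
Qed.

Lemma KM_bounded_fixed (lambda : nat -> R) (x : X) : W_convex W C ->
  closed C -> C x -> unit_itv_seq lambda -> ~ cvgn (series lambda) ->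
  metric_bounded (range (KM_iteration W T lambda x)) ->
  exists2 p, C p & T p = p.
Proof.
move=> Cconv Cclosed Cx lambda01 dvg xb; have [hyp _] := HW.
set u := KM_iteration W T lambda x in xb *.
have uC : forall n, C (u n) by exact: KM_iteration_in.
have C0 : C !=set0 by exists x.
have [c cc] := asymptotic_center_exists _ _ _ HW C0 Cconv Cclosed xb.
have [Cc cr] := cc.
exists c => //; apply: (asymptotic_center_unique _ HW _ _ _ _ Cconv cc).
split=> [|d d0]; first exact: funS.
have d20 : 0 < d / 2 by lra.
have [N _ NP] := cr _ d20.
(* From [N] on, [s] bounds [mdist c (u n)], hence [mdist (T c) (T (u n))]. The excess of
   [mdist (T c) (u n)] over [s] thus obeys the relaxation inequality and is eventually at most
   [d / 2]. *)
pose s := asymptotic_radius C u + d / 2.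
have := @series_dvg_relaxation _ lambda (fun n => mdist (T c) (u n) - s) N
  (d / 2) lambda01 dvg d20.
have step n : (N <= n)%N -> mdist (T c) (u n.+1) - s <=
    (1 - lambda n) * (mdist (T c) (u n) - s).
  move=> Nn; have /andP[l0 l1] := lambda01 n.
  have := W_conv hyp (u n) (T (u n)) (T c) (lambda01 n).
  rewrite -[W _ _ _]/(u n.+1).
  have := Tne _ _ Cc (uC n); have := NP n Nn; rewrite /= -/s; nra.
move=> /(_ step); apply: filterS => n; rewrite /s; lra.
Qed.

(** The distance to a fixed point never increases along the iteration. *)
Lemma KM_fixed_bounded (p x : X) (lambda : nat -> R) : W_convex W C ->
  C p -> T p = p -> C x -> unit_itv_seq lambda ->
  metric_bounded (range (KM_iteration W T lambda x)).
Proof.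
move=> Cconv Cp Tp Cx lambda01; have [hyp _] := HW.
apply: (@metric_bounded_fixed_dist _ _ p _ (mdist x p)); elim=> //= n IHn.
have un := KM_iteration_in _ _ Cconv lambda01 Cx n.
apply: (le_trans (W_conv_l hyp _ _ _ _ (lambda01 n))).
have := Tne _ _ un Cp; rewrite Tp; have /andP[] := lambda01 n; nra.
Qed.

Lemma KM_iteration1 (x : X) (n : nat) :
  KM_iteration W T (fun=> 1) x n = iter n T x.
Proof. by have [hyp _] := HW; elim: n => //= n ->; rewrite (W_weight1 hyp). Qed.

(** Nonexpansiveness keeps the two orbits within [mdist y x] of each other at every index. *)
Lemma Picard_bounded (x y : X) : C x -> C y ->
  metric_bounded (range (fun n => iter n T x)) ->
  metric_bounded (range (fun n => iter n T y)).
Proof.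
move=> Cx Cy [M xM].
have iterC z n : C z -> C (iter n T z).
  by move=> Cz; elim: n => //= n; exact: funS.
apply: (@metric_bounded_fixed_dist _ _ x _ (mdist y x + M)) => n.
rewrite (le_trans (metric_triangle _ (iter n T x) _))// lerD//.
  elim: n => //= n IHn; apply: le_trans IHn; apply: Tne; exact: iterC.
by apply: xM; [exists n|exists 0%N].
Qed.

End fixed_points.

Theorem theorem3p6 (R : realType) (X : completeMetricType R)
    (W : X -> X -> R -> X) (HW : UCW_hyperbolic W)
    (C : set X) (C0 : C !=set0) (Cconv : W_convex W C) (Cclosed : closed C)
    (T : {fun C >-> C}) (Tne : nonexpansive_on C T) :
  [<->
    (* (i) *)
    exists2 p : X, C p & T p = p;
    (* (ii) *)
    exists u : nat -> X,
      [/\ forall n, C (u n),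
          metric_bounded (range u)
        & mdist (u n) (T (u n)) @[n --> \oo] --> (0 : R)];
    (* (iii) *)
    exists2 x : X, C x & metric_bounded (range (fun n => iter n T x));
    (* (iv) *)
    forall x : X, C x -> metric_bounded (range (fun n => iter n T x));
    (* (v) *)
    exists (x : X) (lambda : nat -> R),
      [/\ C x, unit_itv_seq lambda, KM_condition lambda
        & metric_bounded (range (KM_iteration W T lambda x))];
    (* (vi) *)
    forall (x : X) (lambda : nat -> R), C x -> unit_itv_seq lambda ->
      metric_bounded (range (KM_iteration W T lambda x))].
Proof.
have const1 : unit_itv_seq (fun=> 1 : R) by move=> n; rewrite ler01 lexx.
have cond1 : KM_condition (fun=> 1 : R).
  by apply: Or31; exists 1 => //; rewrite ltr01 lexx.
tfae.
- move=> [p Cp Tp]; exists (fun=> p); split => //.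
    by exists 0 => _ _ [? _ <-] [? _ <-]; rewrite mdistxx.
  by rewrite Tp mdistxx; exact: cvg_cst.
(* The way to (iii) is through a fixed point [p], whose own orbit is read as the iteration with
   weights 1. *)
- move=> [u [uC ub uT]].
  have [p Cp Tp] := approx_fixed_point_fixed _ HW _ _ Tne _
    C0 Cconv Cclosed uC ub uT.
  exists p => //; under eq_fun do rewrite -(KM_iteration1 _ HW).
  exact: (KM_fixed_bounded _ HW _ _ Tne _ _ _ Cconv Cp Tp).
- by move=> [x Cx xb] y Cy; exact: (Picard_bounded _ _ Tne _ _ Cx Cy).
(* The constant weight 1 falls under (a). *)
- have [x Cx] := C0; move=> /(_ x Cx) xb; exists x, (fun=> 1); split => //.
  by under eq_fun do rewrite (KM_iteration1 _ HW).
- move=> [x [lambda [Cx lambda01 /KM_condition_dvg dvg xb]]] y mu Cy mu01.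
  have [p Cp Tp] := KM_bounded_fixed _ HW _ _ Tne _ _
    Cconv Cclosed Cx lambda01 dvg xb.
  exact: (KM_fixed_bounded _ HW _ _ Tne _ _ _ Cconv Cp Tp).
- have [x Cx] := C0; move=> /(_ x (fun=> 1) Cx const1).
  apply: (KM_bounded_fixed _ HW _ _ Tne _ _ Cconv Cclosed Cx const1).
  exact: KM_condition_dvg.
Qed.
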